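(* Let $a_0,a_1,b_0,b_1$ be real numbers such that $a(N):=a_1N+a_0>0$ and $b(N):=b_1N+b_0>0$ for every positive integer $N$. For every integer $k\geq1$, letting $I_k(N)$ denote $I_k$ computed with $N$ variables and parameters $a=a(N)$, $b=b(N)$, one has $$\lim_{N\to\infty}\frac{I_k(N)}{N}=\frac{1+a_1}{k(2+a_1+b_1)^k}\sum_{j=0}^{k-1}(-1)^j\left(\frac{1+a_1}{2+a_1+b_1}\right)^j\binom{j+k-1}{j}\sum_{i=0}^{k-1-j}(1+a_1)^i\binom{k}{i+j+1}\binom{k}{i}.$$
   Context: For a positive integer $N$, real numbers $a,b>0$ and a function $f$ of $N$ variables, set $\langle f\rangle_{a,b}=\frac1{N!}\int_{[0,1]^N}f(x_1,\dots,x_N)\prod_{1\le i<j\le N}(x_i-x_j)^2\prod_{i=1}^Nx_i^{a-1}(1-x_i)^{b-1}\,dx_i$. Let $p_k(x_1,\dots,x_N)=\sum_{i=1}^N x_i^k$ and $I_k:=\langle p_k\rangle_{a,b}/\langle 1\rangle_{a,b}$. *)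

(* Defs.v *)
From HB Require Import structures.
From mathcomp Require Import all_boot all_order all_algebra.
From mathcomp Require Import all_classical all_reals all_analysis.
Set Implicit Arguments. Unset Strict Implicit. Unset Printing Implicit Defensive.
Import Order.TTheory GRing.Theory Num.Theory.
Import numFieldNormedType.Exports.
Local Open Scope classical_set_scope.
Local Open Scope ring_scope.

(* Iterated Lebesgue integral over [0,1]^n of a nonnegative (extended-real
   valued) function of the point x : nat -> R (only coordinates < n matter).
   For n = m.+1 the coordinate m is integrated last (outermost). *)
Fixpoint cube_int (R : realType) (n : nat) (F : (nat -> R) -> \bar R) : \bar R :=
  match n with
  | 0 => F (fun _ => 0)
  | m.+1 => (\int[@lebesgue_measure R]_(t in `[0%R, 1%R])
               cube_int m (fun y : nat -> R => F (fun i => if i == m then t else y i)))%E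
  end.

Definition jacobi_weight (R : realType) (N : nat) (a b : R) (x : nat -> R) : R :=
  (\prod_(j < N) \prod_(i < j) (x i - x j) ^+ 2) *
  \prod_(i < N) (powR (x i) (a - 1) * powR (1 - x i) (b - 1)).

Definition jacobi_avg (R : realType) (N : nat) (a b : R) (f : (nat -> R) -> R) : \bar R :=
  ((N`!%:R)^-1%:E * cube_int N (fun x => (f x * jacobi_weight N a b x)%:E))%E.

Definition power_sum (R : realType) (N k : nat) (x : nat -> R) : R :=
  \sum_(i < N) x i ^+ k.

Definition Ik (R : realType) (N k : nat) (a b : R) : R :=
  fine (jacobi_avg N a b (power_sum N k)) / fine (jacobi_avg N a b (fun _ => 1)).

(* Main.v *)
Require Import Defs.
From HB Require Import structures.
From mathcomp Require Import all_boot all_order all_algebra.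
From mathcomp Require Import all_classical all_reals all_analysis.
From mathcomp Require Import perm qpoly measurable_realfun zify ring lra.
Import Order.TTheory GRing.Theory Num.Theory.
Import numFieldNormedType.Exports.
Local Open Scope classical_set_scope.
Local Open Scope ring_scope.
Set Implicit Arguments. Unset Strict Implicit. Unset Printing Implicit Defensive.

(* The average of [p_k] is computed exactly. Writing the squared Vandermonde
   product as a double sum over permutations gives [I_k = tr (H_k H_0^-1)], where
   [H_k = (m_(k+i+j))_(i,j<N)] is built from the moments [m_l] of the beta weight.
   The recurrence of the moments yields [m_(l+j) = m_0 d_l P_j(l)] with
   [deg P_j < N], so Lagrange interpolation at the nodes [0, ..., N-1] expresses
   the rows of [H_k] through those of [H_0], and the trace becomes
   [\sum_(s<N) d_(s+k)/d_s L_s(s+k)]. Only the last [k] terms survive; with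
   [s = N-k+q] and [(z)_k = z (z+1) ... (z+k-1)] they add up to [1/k!] times the
   [(k-1)]-st difference at [q = 0] of
   [q |-> (s+1)_k (a+s)_k / (a+b+N-1+s)_k].
   Differences of [(z+q)_k] and of its inverse are again of this shape, so the
   discrete Leibniz rule gives a sum without cancellation, each of whose terms,
   divided by [N], converges to the corresponding term of the limit. *)

(** * Rising factorials and finite differences *)

Definition rising (R : pzRingType) (z : R) (n : nat) : R := \prod_(i < n) (z + i%:R).

Definition fdiff (R : pzRingType) (f : nat -> R) : nat -> R := fun p => f p.+1 - f p.

Section rising.
Variable R : comPzRingType.
Implicit Types z : R.

Lemma rising0 z : rising z 0 = 1. Proof. exact: big_ord0. Qed.

Lemma risingSr z n : rising z n.+1 = rising z n * (z + n%:R).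
Proof. exact: big_ord_recr. Qed.

Lemma risingD z m n : rising z (m + n) = rising z m * rising (z + m%:R) n.
Proof.
rewrite /rising big_split_ord/=; congr (_ * _).
by apply: eq_bigr => i _; rewrite natrD addrA.
Qed.

Lemma risingSl z n : rising z n.+1 = z * rising (z + 1) n.
Proof. by rewrite -add1n risingD risingSr rising0 mul1r addr0. Qed.

Lemma rising_nat m n : rising (m.+1%:R : R) n = ((m + n) ^_ n)%:R.
Proof.
elim: n => [|n IH]; first by rewrite rising0.
by rewrite risingSr IH addnS ffactSS mulnC natrM -natrD addSn.
Qed.

(** The two products share the factors [z + 1, ..., z + n - 1], and the remaining ones differ by
    [(z + n) - z = n]. For [n = 0] the value [0.-1 = 0] is harmless because of the factor [n]. *)
Lemma rising_sub z n : rising (z + 1) n - rising z n = n%:R * rising (z + 1) n.-1.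
Proof.
case: n => [|n]; first by rewrite !rising0 subrr mul0r.
by rewrite risingSr risingSl /= -natr1; ring.
Qed.

End rising.

Lemma rising_gt0 (R : realDomainType) (z : R) n : 0 < z -> 0 < rising z n.
Proof. by move=> z0; apply: prodr_gt0 => i _; rewrite ltr_wpDr. Qed.

Lemma rising_neq0 (R : realDomainType) (z : R) n : 0 < z -> rising z n != 0.
Proof. by move=> z0; rewrite gt_eqF ?rising_gt0. Qed.

Lemma rising_inv_sub (R : realFieldType) (z : R) n : 0 < z ->
  (rising (z + 1) n)^-1 - (rising z n)^-1 = - n%:R / rising z n.+1.
Proof.
move=> z0; have z1 : 0 < z + 1 by rewrite addr_gt0.
have h1 : rising (z + 1) n != 0 by exact: rising_neq0.
have h2 : rising z n != 0 by exact: rising_neq0.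
have z0' : z != 0 by rewrite gt_eqF.
have zn : z + n%:R != 0 by rewrite gt_eqF// ltr_wpDr.
have E : rising (z + 1) n = z^-1 * (rising z n * (z + n%:R)).
  by rewrite -risingSr risingSl mulKf.
by rewrite risingSr E; field; rewrite zn h2.
Qed.

Section fdiff.
Variable R : comPzRingType.
Implicit Types f g : nat -> R.

(** Pascal's rule under the sum sign. This is the common induction step of [iter_fdiffE] and
    [iter_fdiffM]. *)
Lemma sum_bin_pascal (T : nat -> R) n :
  \sum_(i < n.+2) 'C(n.+1, i)%:R * T i =
  \sum_(i < n.+1) 'C(n, i)%:R * (T i + T i.+1).
Proof.
rewrite big_ord_recl bin0 mul1r.
under [X in _ + X]eq_bigr do rewrite lift0 binS natrD mulrDl.
under [RHS]eq_bigr do rewrite mulrDr.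
rewrite !big_split/= addrA; congr (_ + _).
rewrite [in RHS]big_ord_recl bin0 mul1r; congr (_ + _).
by rewrite big_ord_recr/= bin_small// mul0r addr0.
Qed.

Lemma iter_fdiffE n f p : iter n (@fdiff R) f p =
  \sum_(q < n.+1) 'C(n, q)%:R * ((-1) ^+ (n - q) * f (p + q)%N).
Proof.
elim: n p => [|n IH] p; first by rewrite big_ord1 bin0 !mul1r addn0.
rewrite (@sum_bin_pascal (fun q => (-1) ^+ (n.+1 - q) * f (p + q)%N)).
rewrite iterS {1}/fdiff !IH -sumrB; apply: eq_bigr => q _.
rewrite -mulrBr; congr (_ * _).
by rewrite subSS subSn -1?ltnS// exprS addSnnS; ring.
Qed.

(** The discrete Leibniz rule. It rests on [f q.+1 * g q.+1 - f q * g q = (f q.+1 - f q) * g q.+1 +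
    f q * (g q.+1 - g q)], whence the shifted argument [p + i] of [g]. *)
Lemma iter_fdiffM n f g p : iter n (@fdiff R) (fun q => f q * g q) p =
  \sum_(i < n.+1) 'C(n, i)%:R *
    (iter i (@fdiff R) f p * iter (n - i) (@fdiff R) g (p + i)%N).
Proof.
elim: n p => [|n IH] p; first by rewrite big_ord1 bin0 !mul1r addn0.
rewrite (@sum_bin_pascal
  (fun i => iter i (@fdiff R) f p * iter (n.+1 - i) (@fdiff R) g (p + i)%N)).
rewrite iterS {1}/fdiff !IH -sumrB; apply: eq_bigr => i _.
rewrite -mulrBr; congr (_ * _).
by rewrite subSS subSn -1?ltnS// !iterS /fdiff addSnnS addnS; ring.
Qed.

(** Each difference removes a factor, raises the base by one and brings out the current length; the
    lengths [k, k - 1, ...] multiply to [k ^_ n], which is 0 once [n > k]. *)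
Lemma iter_fdiff_rising (z : R) k n p :
  iter n (@fdiff R) (fun q => rising (z + q%:R) k) p =
  (k ^_ n)%:R * rising (z + (p + n)%:R) (k - n).
Proof.
elim: n p => [|n IH] p; first by rewrite ffactn0 mul1r addn0 subn0.
rewrite iterS /fdiff !IH -mulrBr addSn -natr1 addrA rising_sub.
by rewrite ffactnSr natrM -mulrA -subnS addnS -natr1 addrA.
Qed.

End fdiff.

(** For inverses each difference adds a factor instead, keeps the base and brings out minus the
    current length, so that [k, k + 1, ...] multiply to a rising factorial. *)
Lemma iter_fdiff_rising_inv (R : realFieldType) (z : R) k n p : 0 < z ->
  iter n (@fdiff R) (fun q => (rising (z + q%:R) k)^-1) p =
  (-1) ^+ n * rising k%:R n / rising (z + p%:R) (k + n).
Proof.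
move=> z0; elim: n p => [|n IH] p; first by rewrite rising0 addn0 !mul1r.
rewrite iterS /fdiff !IH -mulrBr -natr1 addrA rising_inv_sub; last by rewrite ltr_wpDr.
by rewrite exprS [rising k%:R n.+1]risingSr natrD addnS; ring.
Qed.

(** * The beta integral *)

(** The open interval is exhausted by closed ones, on which the ordinary fundamental theorem
    applies. Monotone convergence gives the limit of the integrals, and the one-sided limits of [F]
    give its value. *)
Lemma ge0_improper_FTC2 (R : realType) (f F : R -> R) (u v : R) : u < v ->
  {in `]u, v[, forall x, 0 <= f x} ->
  {in `]u, v[, continuous f} ->
  {in `]u, v[, forall x, is_derive x (1 : R) F (f x)} ->
  F x @[x --> u^'+] --> F u -> F x @[x --> v^'-] --> F v ->
  (\int[@lebesgue_measure R]_(x in `]u, v[) (f x)%:E = (F v - F u)%:E)%E.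
Proof.
move=> uv f0 cf dF Fu Fv.
(* The denominator starts at 3, so that [2 * e n < v - u] and no closed interval degenerates. *)
pose e (n : nat) : R := (v - u) / n.+3%:R.
have e0 n : 0 < e n by rewrite divr_gt0 ?subr_gt0.
have e3 n : 3 * e n <= v - u.
  rewrite /e mulrCA ger_pMr ?subr_gt0// ler_pdivrMr// mul1r ler_nat//.
have uev n : u + e n < v - e n by have := e3 n; have := e0 n; lra.
have e_cvg : e n @[n --> \oo] --> (0 : R).
  rewrite /e -[X in _ --> X](mulr0 (v - u)); apply: cvgM; first exact: cvg_cst.
  have := @cvg_harmonic R.
  rewrite -(cvg_shiftn 2); apply: cvg_trans; apply: near_eq_cvg.
  by near=> n; rewrite /harmonic/= addn2.
have ec n : {in `[u + e n, v - e n], forall x, x \in `]u, v[}.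
  move=> x; rewrite !in_itv/= => /andP[]; have := e0 n => ? ? ?.
  by apply/andP; split; lra.
have dcont (x : R) : x \in `]u, v[ -> {for x, continuous F}.
  move=> xi; have dx := dF _ xi.
  by apply: differentiable_continuous; apply/derivable1_diffP; apply: ex_derive.
have FTCn n : (\int[@lebesgue_measure R]_(x in `[(u + e n)%R, (v - e n)%R]) (f x)%:E
   = (F (v - e n)%R - F (u + e n)%R)%:E)%E.
  rewrite (@continuous_FTC2 _ f F)//.
  - apply: continuous_in_subspaceT => x; rewrite inE/= => xi.
    by apply: cf; exact: (ec n).
  - split.
    + move=> x xi; have dx : is_derive x (1 : R) F (f x).
        by apply: dF; apply: (ec n); apply: subset_itvW xi.
      exact: ex_derive.
    + apply: cvg_at_right_filter; apply: dcont; apply: (ec n).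
      by rewrite in_itv/= lexx ltW.
    + apply: cvg_at_left_filter; apply: dcont; apply: (ec n).
      by rewrite in_itv/= lexx ltW.
  - move=> x xi; have dx : is_derive x (1 : R) F (f x).
      by apply: dF; apply: (ec n); apply: subset_itvW xi.
    by rewrite derive1E derive_val.
have cup : \bigcup_n `[u + e n, v - e n]%classic = `]u, v[%classic.
  apply/seteqP; split=> x; first by move=> [n _]; exact: (ec n).
  rewrite /= in_itv/= => /andP[ux xv].
  have : \forall n \near \oo, e n < Num.min (x - u) (v - x).
    have : 0 < Num.min (x - u) (v - x) by rewrite lt_min !subr_gt0 ux xv.
    exact: (cvgr_lt _ e_cvg).
  move=> [N _ /(_ N (leqnn _))]; rewrite lt_min => /andP[h1 h2].
  exists N => //; rewrite /= in_itv/=.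
  by apply/andP; split; lra.
have nd : nondecreasing_seq (fun n => `[u + e n, v - e n]%classic).
  move=> m n mn; apply/subsetPset => x; rewrite /= !in_itv/= => /andP[h1 h2].
  have : e n <= e m.
    by rewrite ler_pM2l ?subr_gt0// lef_pV2 ?posrE// ler_nat !ltnS.
  by move=> ?; apply/andP; split; lra.
have : (\int[@lebesgue_measure R]_(x in `[(u + e n)%R, (v - e n)%R]) (f x)%:E @[n --> \oo]
   --> \int[@lebesgue_measure R]_(x in `]u, v[) (f x)%:E)%E.
  rewrite -cup; apply: ge0_nondecreasing_set_cvg_integral => //.
  - move=> n; apply/measurable_realfun.measurable_EFinP.
    apply: (@measurable_funS _ _ _ _ `]u, v[%classic) => //; first by move=> x; exact: (ec n).
    by apply: measurable_realfun.open_continuous_measurable_fun => // x; rewrite inE => /cf.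
  - by move=> n x /= xi; rewrite lee_fin f0//; exact: (ec n).
have : (\int[@lebesgue_measure R]_(x in `[(u + e n)%R, (v - e n)%R]) (f x)%:E @[n --> \oo]
   --> (F v - F u)%:E)%E.
  under eq_fun do rewrite FTCn.
  apply: cvg_EFin; first exact: nearW.
  apply: cvgB.
  - move/cvg_at_leftP : Fv; apply; split => [n|]; first by rewrite ltrBlDr ltrDl.
    by rewrite -[X in _ --> X]subr0; apply: cvgB => //; exact: cvg_cst.
  - move/cvg_at_rightP : Fu; apply; split => [n|]; first by rewrite ltrDl.
    by rewrite -[X in _ --> X]addr0; apply: cvgD => //; exact: cvg_cst.
by move=> h1 h2; apply: (cvg_unique _ h2 h1).
Unshelve. all: by end_near. Qed.

Definition beta_weight (R : realType) (p q x : R) : R :=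
  powR x (p - 1) * powR (1 - x) (q - 1).

Section beta.
Context {R : realType}.
Implicit Types p q x : R.
Notation mu := (@lebesgue_measure R).

Lemma is_derive_powR_onem q x : x < 1 ->
  is_derive x (1 : R) (fun y => powR (1 - y) q) (- (q * powR (1 - x) (q - 1))).
Proof.
move=> x1.
have h1 : is_derive x (1 : R) (fun y : R => 1 - y) (-1).
  by apply: is_derive_eq; rewrite add0r mul1r.
have h2 : is_derive (1 - x) (1 : R) (fun y => powR y q) (q * powR (1 - x) (q - 1)).
  by apply: is_derive1_powR; rewrite subr_gt0.
have := @is_derive1_comp R (fun y => powR y q) (fun y : R => 1 - y) x _ _ h2 h1.
by rewrite mulrN1.
Qed.

Lemma powR_onem_cvg0 q : 0 < q -> powR (1 - x) q @[x --> (1 : R)^'-] --> (0 : R).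
Proof.
move=> q0; apply/cvg_at_leftP => u [u1 ucvg].
have /cvg_at_rightP/(_ (fun n => 1 - u n)) := powR_cvg0 q0; apply; split.
  by move=> n; rewrite subr_gt0.
rewrite -[X in _ --> X](subrr 1); apply: cvgB => //; exact: cvg_cst.
Qed.

Lemma continuous_powR_gt0 p x : 0 < x -> {for x, continuous (fun y : R => powR y p)}.
Proof.
move=> x0; have dx := @is_derive1_powR R p x x0.
by apply: differentiable_continuous; apply/derivable1_diffP; apply: ex_derive.
Qed.

Lemma continuous_powR_onem q x : x < 1 -> {for x, continuous (fun y : R => powR (1 - y) q)}.
Proof.
move=> x0; have dx := is_derive_powR_onem q x0.
by apply: differentiable_continuous; apply/derivable1_diffP; apply: ex_derive.
Qed.

Lemma powR_cvg1l p : powR x p @[x --> (1 : R)^'-] --> (1 : R).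
Proof.
rewrite -[X in _ --> X](_ : powR 1 p = 1); last by rewrite powR1.
by apply: cvg_at_left_filter; exact: (@continuous_powR_gt0 p 1 ltr01).
Qed.

Lemma powR_onem_cvg1r q : powR (1 - x) q @[x --> (0 : R)^'+] --> (1 : R).
Proof.
rewrite -[X in _ --> X](_ : powR (1 - 0) q = 1); last by rewrite subr0 powR1.
by apply: cvg_at_right_filter; exact: (@continuous_powR_onem q 0 ltr01).
Qed.

Lemma beta_weight_ge0 p q x : 0 <= beta_weight p q x.
Proof. by rewrite mulr_ge0 ?powR_ge0. Qed.

Lemma continuous_beta_weight p q :
  {in `]0, 1[, continuous (beta_weight p q)}.
Proof.
move=> x; rewrite in_itv/= => /andP[x0 x1].
suff : {for x, continuous ((fun y : R => powR y (p - 1)) \* (fun y => powR (1 - y) (q - 1)))} by [].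
by apply: continuousM; [exact: continuous_powR_gt0|exact: continuous_powR_onem].
Qed.

Lemma measurable_beta_weight p q : measurable_fun (`]0%R, 1%R[ : set R) (beta_weight p q).
Proof.
apply: open_continuous_measurable_fun => // x; rewrite inE.
exact: continuous_beta_weight.
Qed.

Lemma beta_weightS p q x : x \in `]0, 1[ ->
  beta_weight (p + 1) q x = x * beta_weight p q x.
Proof.
rewrite in_itv/= => /andP[x0 x1]; rewrite /beta_weight mulrA; congr (_ * _).
rewrite addrAC [LHS]powRD; last by rewrite (gt_eqF x0) implybT.
by rewrite powRr1 ?ltW// mulrC.
Qed.

Lemma beta_weight_onemS p q x : x \in `]0, 1[ ->
  beta_weight p (q + 1) x = (1 - x) * beta_weight p q x.
Proof.
rewrite in_itv/= => /andP[x0 x1]; rewrite /beta_weight mulrCA; congr (_ * _).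
have x1' : 0 < 1 - x by rewrite subr_gt0.
rewrite addrAC [LHS]powRD; last by rewrite (gt_eqF x1') implybT.
by rewrite powRr1 ?ltW// mulrC.
Qed.

(** Written as a linear polynomial times [beta_weight p q], the derivative integrates to a relation
    between neighbouring beta integrals; for [p, q > 0] its sign changes only at [p / (p + q)]. *)
Lemma is_derive_beta_prod p q x : x \in `]0, 1[ ->
  is_derive x (1 : R) (fun y => powR y p * powR (1 - y) q)
    ((p - (p + q) * x) * beta_weight p q x).
Proof.
move=> xi; have := xi; rewrite in_itv/= => /andP[x0 x1].
have h1 := @is_derive1_powR R p x x0.
have h2 := is_derive_powR_onem q x1.
have h3 := @is_deriveM _ _ _ _ _ _ _ _ h1 h2.
apply: is_derive_eq h3 _.
rewrite /GRing.scale/=.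
have e1 : powR x p = x * powR x (p - 1).
  by have := @beta_weightS p 1 x xi; rewrite /beta_weight subrr !powRr0 !mulr1 addrK.
have e2 : powR (1 - x) q = (1 - x) * powR (1 - x) (q - 1).
  by have := @beta_weight_onemS 1 q x xi; rewrite /beta_weight subrr !powRr0 !mul1r addrK.
by rewrite e1 e2 /beta_weight; ring.
Qed.

Lemma integral_powR_onem q : 0 < q ->
  (\int[mu]_(x in `]0%R, 1%R[) (powR (1 - x) (q - 1))%:E = (q^-1)%:E)%E.
Proof.
move=> q0.
rewrite (@ge0_improper_FTC2 _ (fun x => powR (1 - x) (q - 1))
  (fun x => - (q^-1 * powR (1 - x) q)))//.
- by rewrite subrr powR0 ?gt_eqF// subr0 powR1 mulr0 mulr1 oppr0 add0r opprK.
- by move=> x _; exact: powR_ge0.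
- by move=> x; rewrite in_itv/= => /andP[_]; exact: continuous_powR_onem.
- move=> x; rewrite in_itv/= => /andP[_ x1].
  have h := is_derive_powR_onem q x1.
  apply: is_derive_eq; rewrite /GRing.scale/= mulrN opprK mulrA mulVf ?mul1r//.
  by rewrite gt_eqF.
- apply: cvgN; apply: cvgM; first exact: cvg_cst.
  by rewrite subr0 powR1; exact: powR_onem_cvg1r.
- apply: cvgN; apply: cvgM; first exact: cvg_cst.
  by rewrite subrr powR0 ?gt_eqF//; exact: powR_onem_cvg0.
Qed.

Lemma integral_powR p : 0 < p ->
  (\int[mu]_(x in `]0%R, 1%R[) (powR x (p - 1))%:E = (p^-1)%:E)%E.
Proof.
move=> p0.
rewrite (@ge0_improper_FTC2 _ (fun x => powR x (p - 1)) (fun x => p^-1 * powR x p))//.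
- by rewrite powR0 ?gt_eqF// powR1 mulr0 mulr1 subr0.
- by move=> x _; exact: powR_ge0.
- by move=> x; rewrite in_itv/= => /andP[+ _]; exact: continuous_powR_gt0.
- move=> x; rewrite in_itv/= => /andP[x0 _].
  have h := @is_derive1_powR R p x x0.
  apply: is_derive_eq; rewrite /GRing.scale/= mulrA mulVf ?mul1r//.
  by rewrite gt_eqF.
- apply: cvgM; first exact: cvg_cst.
  by rewrite powR0 ?gt_eqF//; exact: powR_cvg0.
- apply: cvgM; first exact: cvg_cst.
  by rewrite powR1; exact: powR_cvg1l.
Qed.

Let ge0_integrable (f : R -> R) (l : R) : measurable_fun (`]0%R, 1%R[ : set R) f ->
  (forall x, 0 <= f x) -> (\int[mu]_(x in `]0%R, 1%R[) (f x)%:E = l%:E)%E ->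
  mu.-integrable `]0%R, 1%R[ (EFin \o f).
Proof.
move=> mf f0 fl; apply/integrableP; split; first exact/measurable_EFinP.
under eq_integral do rewrite /= ger0_norm//.
by rewrite fl ltry.
Qed.

Let integrable_powR p : 0 < p ->
  mu.-integrable `]0%R, 1%R[ (EFin \o (fun x => powR x (p - 1))).
Proof.
move=> p0; apply: ge0_integrable (integral_powR p0); last by move=> x; exact: powR_ge0.
apply: open_continuous_measurable_fun => // x; rewrite inE/= in_itv/=.
by move=> /andP[+ _]; exact: continuous_powR_gt0.
Qed.

Let integrable_powR_onem q : 0 < q ->
  mu.-integrable `]0%R, 1%R[ (EFin \o (fun x => powR (1 - x) (q - 1))).
Proof.
move=> q0; apply: ge0_integrable (integral_powR_onem q0); last by move=> x; exact: powR_ge0.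
apply: open_continuous_measurable_fun => // x; rewrite inE/= in_itv/=.
by move=> /andP[_]; exact: continuous_powR_onem.
Qed.

Lemma powR_le1 p x : 0 < p -> 0 < x -> x < 1 -> powR x p <= 1.
Proof.
move=> p0 x0 x1; rewrite -(powRr0 x) ger_powR ?(ltW p0)//.
by rewrite x0 ltW.
Qed.

(** Splitting [1 = (1 - x) + x] bounds the weight by [x^(p-1) + (1-x)^(q-1)], whose two summands
    have explicit antiderivatives. *)
Lemma integrable_beta_weight p q : 0 < p -> 0 < q ->
  mu.-integrable `]0%R, 1%R[ (EFin \o beta_weight p q).
Proof.
move=> p0 q0.
have := integrableD _ (integrable_powR p0) (integrable_powR_onem q0).
move=> /(_ (measurable_itv _)); apply: le_integrable => //.
  by apply/measurable_EFinP; exact: measurable_beta_weight.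
move=> x /= xi; rewrite !ger0_norm ?beta_weight_ge0 ?addr_ge0 ?powR_ge0// lee_fin.
move: (xi); rewrite in_itv/= => /andP[x0 x1].
have -> : beta_weight p q x = beta_weight p (q + 1) x + beta_weight (p + 1) q x.
  by rewrite beta_weightS// beta_weight_onemS//; ring.
rewrite /beta_weight !addrK lerD//.
  by rewrite ler_piMr ?powR_ge0// powR_le1 ?subr_gt0// gtrBl.
by rewrite ler_piMl ?powR_ge0// powR_le1.
Qed.


(** Euler's beta function, taken over the open interval, where the weight is continuous. *)
Definition beta_int p q : R := \int[mu]_(x in `]0%R, 1%R[) beta_weight p q x.

(** The function [x^p (1-x)^q] vanishes at both endpoints, so the integral of its derivative [p *
    beta_weight p q - (p + q) * beta_weight (p + 1) q] is 0. *)
Lemma beta_intS p q : 0 < p -> 0 < q ->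
  (p + q) * beta_int (p + 1) q = p * beta_int p q.
Proof.
move=> p0 q0.
have p1 : 0 < p + 1 by rewrite addr_gt0.
pose g x := (p * beta_weight p q x - (p + q) * beta_weight (p + 1) q x)
  + q * powR (1 - x) (q - 1).
have gE x : x \in `]0, 1[ -> g x = (p - (p + q) * x) * beta_weight p q x
    + q * powR (1 - x) (q - 1).
  by move=> xi; rewrite /g beta_weightS//; ring.
(* The second summand of [g] makes it nonnegative without spoiling its antiderivative. *)
have : (\int[mu]_(x in `]0%R, 1%R[) (g x)%:E = 1%:E)%E.
  rewrite (@ge0_improper_FTC2 _ g
    (fun x => powR x p * powR (1 - x) q - powR (1 - x) q))//.
  - by rewrite subrr subr0 powR1 !powR0 ?gt_eqF//; congr (_%:E); ring.
  - move=> x xi; rewrite gE//; move: (xi); rewrite in_itv/= => /andP[x0 x1].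
    (* Both summands on the right are nonnegative: the last bracket equals
       [(1-x)^(q-1) (1 - x^p)]. *)
    have -> : (p - (p + q) * x) * beta_weight p q x + q * powR (1 - x) (q - 1)
      = p * ((1 - x) * beta_weight p q x)
        + q * (powR (1 - x) (q - 1) - x * beta_weight p q x) by ring.
    rewrite addr_ge0// mulr_ge0 ?(ltW p0) ?(ltW q0)//.
      by rewrite mulr_ge0 ?beta_weight_ge0// subr_ge0 ltW.
    rewrite -beta_weightS// /beta_weight addrK subr_ge0 ler_piMl ?powR_ge0//.
    exact: powR_le1.
  - move=> x xi; have xi' := xi; move: xi'; rewrite in_itv/= => /andP[x0 x1].
    rewrite /continuous_at /g; apply: cvgD; last first.
      by apply: cvgM; [exact: cvg_cst|exact: continuous_powR_onem].
    by apply: cvgB; (apply: cvgM; [exact: cvg_cst|exact: continuous_beta_weight]).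
  - move=> x xi; have xi' := xi; move: xi'; rewrite in_itv/= => /andP[x0 x1].
    have h1 := is_derive_beta_prod p q xi.
    have h2 := is_derive_powR_onem q x1.
    by apply: is_derive_eq; rewrite opprK gE.
  - apply: cvgB; first apply: cvgM.
    + by rewrite powR0 ?gt_eqF//; exact: powR_cvg0.
    + by rewrite subr0 powR1; exact: powR_onem_cvg1r.
    + by rewrite subr0 powR1; exact: powR_onem_cvg1r.
  - apply: cvgB; first apply: cvgM.
    + by rewrite powR1; exact: powR_cvg1l.
    + by rewrite subrr powR0 ?gt_eqF//; exact: powR_onem_cvg0.
    + by rewrite subrr powR0 ?gt_eqF//; exact: powR_onem_cvg0.
move=> /(congr1 fine)/=; rewrite -/(Rintegral mu _ g).
have i1 := integrable_beta_weight p0 q0.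
have i2 := integrable_beta_weight p1 q0.
have i3 := integrable_powR_onem q0.
have iZ (r : R) (f : R -> R) : mu.-integrable `]0%R, 1%R[ (EFin \o f) ->
    mu.-integrable `]0%R, 1%R[ (EFin \o (fun x => r * f x)).
  by move=> fi; apply: (@integrableZl _ _ _ _ _ _ r _ fi); exact: measurable_itv.
rewrite /g RintegralD//; last 2 first.
- by apply: (@integrableB _ _ _ _ _ _ _ _ (iZ p _ i1) (iZ (p + q) _ i2)); exact: measurable_itv.
- exact: iZ.
rewrite RintegralB//; [|exact: iZ|exact: iZ].
rewrite !RintegralZl// {3}/Rintegral integral_powR_onem//= -!/(beta_int _ _).
rewrite mulfV ?gt_eqF// => h; lra.
Qed.

(** On []0, x0[], where [x0 = p / (p + q)] maximizes [x^p (1-x)^q], the derivative of this product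
    is nonnegative and at most [p * beta_weight p q]. Integration yields the positive lower bound
    [x0^p (1-x0)^q] for [p * beta_int p q]. *)
Lemma beta_int_gt0 p q : 0 < p -> 0 < q -> 0 < beta_int p q.
Proof.
move=> p0 q0.
have pq0 : 0 < p + q by rewrite addr_gt0.
pose x0 := p / (p + q).
have x00 : 0 < x0 by rewrite divr_gt0.
have x01 : x0 < 1 by rewrite ltr_pdivrMr// mul1r ltrDl.
have sub x : x \in `]0, x0[ -> x \in `]0, 1[.
  by rewrite !in_itv/= => /andP[-> /= xx0]; exact: lt_trans x01.
pose g x := p * beta_weight p q x - (p + q) * beta_weight (p + 1) q x.
have gE x : x \in `]0, 1[ -> g x = (p - (p + q) * x) * beta_weight p q x.
  by move=> xi; rewrite /g beta_weightS//; ring.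
have cg : {in `]0, 1[, continuous g}.
  move=> x xi.
  rewrite /continuous_at /g.
  by apply: cvgB; (apply: cvgM; [exact: cvg_cst|exact: continuous_beta_weight]).
have g0 x : x \in `]0, x0[ -> 0 <= g x.
  move=> xi; rewrite gE ?sub// mulr_ge0 ?beta_weight_ge0// subr_ge0.
  by move: xi; rewrite in_itv/= => /andP[_ /ltW]; rewrite ler_pdivlMr// mulrC.
have x0i : x0 \in `]0, 1[ by rewrite in_itv/= x00.
have gint : (\int[mu]_(x in `]0%R, x0[) (g x)%:E = (powR x0 p * powR (1 - x0) q)%:E)%E.
  rewrite (@ge0_improper_FTC2 _ g (fun x => powR x p * powR (1 - x) q))//.
  - by rewrite powR0 ?gt_eqF// mul0r subr0.
  - by move=> x /sub; exact: cg.
  - move=> x /sub xi; have h1 := is_derive_beta_prod p q xi.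
    by apply: is_derive_eq; rewrite gE.
  - apply: cvgM.
    + by rewrite powR0 ?gt_eqF//; exact: powR_cvg0.
    + by rewrite subr0 powR1; exact: powR_onem_cvg1r.
  - apply: cvg_at_left_filter; apply: cvgM; first exact: continuous_powR_gt0.
    exact: continuous_powR_onem.
have le1 : (\int[mu]_(x in `]0%R, x0[) (g x)%:E <=
            \int[mu]_(x in `]0%R, 1%R[) (p * beta_weight p q x)%:E)%E.
  apply: (@le_trans _ _ (\int[mu]_(x in `]0%R, x0[) (p * beta_weight p q x)%:E)%E).
    apply: ge0_le_integral => //.
    - apply/measurable_EFinP; apply: open_continuous_measurable_fun => // x.
      by rewrite inE => /sub; exact: cg.
    - apply/measurable_EFinP; apply: measurable_funM; first exact: measurable_cst.
      by apply: measurable_funS (measurable_beta_weight p q).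
    - move=> x xi; rewrite lee_fin /g gerBl mulr_ge0 ?(ltW pq0)// beta_weight_ge0//.
  apply: ge0_subset_integral => //.
  - apply/measurable_EFinP; apply: measurable_funM; first exact: measurable_cst.
    exact: measurable_beta_weight.
  - by move=> x _; rewrite lee_fin mulr_ge0 ?(ltW p0) ?beta_weight_ge0.
have ib := integrable_beta_weight p0 q0.
have e1 : (\int[mu]_(x in `]0%R, 1%R[) (p * beta_weight p q x)%:E =
           (p * beta_int p q)%:E)%E.
  under eq_integral do rewrite EFinM.
  rewrite integralZl// EFinM /beta_int /Rintegral fineK//.
  exact: integrable_fin_num.
move: le1; rewrite e1 gint lee_fin => h.
rewrite -(pmulr_rgt0 _ p0); apply: lt_le_trans h.
by rewrite mulr_gt0// powR_gt0// subr_gt0.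
Qed.

(** The moment of order [n] as a beta integral with shifted parameter, so that [beta_intS] becomes
    its recurrence; [integral_expr_beta_weight] identifies it with the integral of [x ^+ n] against
    the weight. *)
Definition beta_moment (a b : R) (n : nat) : R := beta_int (a + n%:R) b.

Lemma beta_weight_expr (a b : R) (n : nat) x : x \in `]0, 1[ ->
  x ^+ n * beta_weight a b x = beta_weight (a + n%:R) b x.
Proof.
move=> xi; elim: n => [|n IH]; first by rewrite expr0 mul1r addr0.
by rewrite exprS -mulrA IH -beta_weightS// -addrA natr1.
Qed.

Let measurable_expr_beta_weight (a b : R) (n : nat) :
  measurable_fun [set: R] (fun x => x ^+ n * beta_weight a b x).
Proof.
apply: measurable_funM; first exact: exprn_measurable.
apply: measurable_funM; first exact: measurable_powR.
apply: (@measurableT_comp _ _ _ _ _ _ (fun y : R => powR y (b - 1)) _ (fun x : R => 1 - x)).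
  exact: measurable_powR.
by apply: measurable_funB; [exact: measurable_cst|exact: measurable_id].
Qed.

Lemma integrable_expr_beta_weight (a b : R) (n : nat) : 0 < a -> 0 < b ->
  mu.-integrable `[0%R, 1%R] (EFin \o (fun x => x ^+ n * beta_weight a b x)).
Proof.
move=> a0 b0; apply/integrableP; split.
  apply/measurable_EFinP; apply: measurable_funTS.
  exact: measurable_expr_beta_weight.
rewrite integral_itv_bndoo; last first.
  apply: measurableT_comp => //; apply/measurable_EFinP; apply: measurable_funTS.
  exact: measurable_expr_beta_weight.
have an0 : 0 < a + n%:R by rewrite ltr_wpDr.
have /integrableP[_] := integrable_beta_weight an0 b0; apply: le_lt_trans.
rewrite le_eqVlt; apply/orP; left; apply/eqP.
by apply: eq_integral => x; rewrite inE => xi /=; rewrite beta_weight_expr.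
Qed.

Lemma integral_expr_beta_weight (a b : R) (n : nat) : 0 < a -> 0 < b ->
  (\int[mu]_(x in `[0%R, 1%R]) (x ^+ n * beta_weight a b x)%:E = (beta_moment a b n)%:E)%E.
Proof.
(* The endpoints form a null set; on the open interval [beta_weight_expr] applies. *)
move=> a0 b0; rewrite integral_itv_bndoo; last first.
  apply/measurable_EFinP; apply: measurable_funTS.
  exact: measurable_expr_beta_weight.
have an0 : 0 < a + n%:R by rewrite ltr_wpDr.
have ib := integrable_beta_weight an0 b0.
rewrite /beta_moment /beta_int /Rintegral fineK; last exact: integrable_fin_num.
by apply: eq_integral => x; rewrite inE => xi /=; rewrite beta_weight_expr.
Qed.

Lemma beta_momentS (a b : R) (n : nat) : 0 < a -> 0 < b ->
  (a + b + n%:R) * beta_moment a b n.+1 = (a + n%:R) * beta_moment a b n.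
Proof.
move=> a0 b0; rewrite /beta_moment -beta_intS// ?ltr_wpDr//.
by rewrite -natr1 addrA (addrAC a b).
Qed.

End beta.

(** * Expansion of the Jacobi averages *)

(** Induction on [n], with the coefficients [c] general: for a fixed value of the outermost
    variable, its factor is absorbed into the coefficients of the inner integral. Integrability of
    the factors justifies linearity, since the terms may have any sign. *)
Lemma cube_int_sum_prod (R : realType) (I : Type) (s : seq I) (n : nat) (c : I -> R)
    (g : I -> 'I_n -> R -> R) (m : I -> 'I_n -> R) :
  (forall i j, (@lebesgue_measure R).-integrable `[0%R, 1%R] (EFin \o g i j)) ->
  (forall i j, (\int[@lebesgue_measure R]_(x in `[0%R, 1%R]) (g i j x)%:E = (m i j)%:E)%E) ->
  cube_int n (fun x => (\sum_(i <- s) c i * \prod_(j < n) g i j (x j))%:E) =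
  (\sum_(i <- s) c i * \prod_(j < n) m i j)%:E.
Proof.
elim: n => [|n IH] in c g m *; move=> gi gm.
  by rewrite /=; congr (_%:E); apply: eq_bigr => i _; rewrite !big_ord0.
pose wd := @widen_ord n n.+1 (leqnSn n).
pose h i t := c i * g i ord_max t.
rewrite /=.
transitivity (\int[@lebesgue_measure R]_(t in `[0%R, 1%R])
    (\sum_(i <- s) (h i t * \prod_(j < n) m i (wd j))%:E))%E.
  apply: eq_integral => t _; rewrite sumEFin.
  rewrite -(IH (h ^~ t) (fun i j => g i (wd j)))//.
  congr cube_int; apply/funext => y; congr (_%:E); apply: eq_bigr => i _.
  rewrite big_ord_recr/= eqxx /h -!mulrA; congr (_ * _).
  rewrite mulrC; congr (_ * _); apply: eq_bigr => j _.
  by rewrite ltn_eqF.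
have hE i : (fun t => (h i t * \prod_(j < n) m i (wd j))%:E) =
    (fun t => (c i * \prod_(j < n) m i (wd j))%:E * (g i ord_max t)%:E)%E.
  by apply/funext => t; rewrite -EFinM /h mulrAC.
rewrite integral_sum//; last first.
  move=> i; rewrite hE.
  by apply: (@integrableZl _ _ _ _ _ _ _ _ (gi i ord_max)); exact: measurable_itv.
rewrite -sumEFin; apply: eq_bigr => i _.
rewrite hE integralZl//; last exact: gi.
by rewrite gm -EFinM big_ord_recr/= mulrA.
Qed.

(** The product is the square of a Vandermonde determinant, and each of the two factors is expanded
    by the Leibniz formula. *)
Lemma vandermonde_sqr (R : comPzRingType) (n : nat) (x : nat -> R) :
  \prod_(j < n) \prod_(i < j) (x i - x j) ^+ 2 =
  \sum_(st : 'S_n * 'S_n) (-1) ^+ st.1 * (-1) ^+ st.2 *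
    \prod_(i < n) x i ^+ (st.1 i + st.2 i).
Proof.
pose V : 'M[R]_n := \matrix_(i, j) x i ^+ j.
have -> : \prod_(j < n) \prod_(i < j) (x i - x j) ^+ 2 = \det V ^+ 2.
  have -> : V = (Vandermonde n (\row_j x j))^T by apply/matrixP => i j; rewrite !mxE.
  rewrite det_tr det_Vandermonde -prodrXl.
  under [RHS]eq_bigr do rewrite -prodrXl.
  rewrite [RHS](exchange_big_dep predT)//=.
  apply: eq_bigr => j _.
  rewrite (big_ord_widen n (fun i => (x i - x j) ^+ 2)) 1?ltnW//.
  by apply: eq_bigr => i _; rewrite !mxE -(sqrrN (x j - x i)) opprB.
rewrite expr2 /(\det V) big_distrlr/= pair_bigA/=.
apply: eq_bigr => -[s t] _ /=; rewrite mulrACA; congr (_ * _).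
by rewrite -big_split/=; apply: eq_bigr => i _; rewrite !mxE exprD.
Qed.

(** With one of the two permutations fixed, the sum over the other is again a Leibniz formula, now
    for a determinant of moments. Sums of monomials cover both [1] and [power_sum]. *)
Lemma jacobi_avgE (R : realType) (N : nat) (a b : R) (I : finType) (e : I -> 'I_N -> nat) :
  0 < a -> 0 < b ->
  jacobi_avg N a b (fun x => \sum_(k : I) \prod_(i < N) x i ^+ e k i) =
  ((N`!%:R)^-1 * \sum_(k : I) \sum_(s : 'S_N) (-1) ^+ s *
    \det (\matrix_(i < N, j < N) beta_moment a b (e k i + s i + j)))%:E.
Proof.
move=> a0 b0; rewrite /jacobi_avg EFinM; congr (_ * _)%E.
pose J := (I * ('S_N * 'S_N))%type.
pose c (p : J) : R := (-1) ^+ p.2.1 * (-1) ^+ p.2.2.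
pose E (p : J) (i : 'I_N) := (e p.1 i + p.2.1 i + p.2.2 i)%N.
have -> : cube_int N (fun x =>
      ((\sum_k \prod_(i < N) x i ^+ e k i) * jacobi_weight N a b x)%:E) =
    cube_int N (fun x => (\sum_(p : J) c p *
      \prod_(i < N) (x i ^+ E p i * beta_weight a b (x i)))%:E).
  congr cube_int; apply/funext => x; congr (_%:E).
  rewrite /jacobi_weight vandermonde_sqr mulrA big_distrlr/= pair_bigA/=.
  rewrite mulr_suml; apply: eq_bigr => -[k [s t]] _ /=.
  rewrite mulrCA -mulrA /c/=; congr (_ * _).
  rewrite -!big_split/=; apply: eq_bigr => i _.
  by rewrite -exprD addnA.
rewrite (@cube_int_sum_prod R J _ N c (fun p i x => x ^+ E p i * beta_weight a b x)
  (fun p i => beta_moment a b (E p i))); last 2 first.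
- by move=> p i; exact: integrable_expr_beta_weight.
- by move=> p i; exact: integral_expr_beta_weight.
congr (_%:E).
pose G (p : J) := c p * \prod_(i < N) beta_moment a b (E p i).
transitivity (\sum_(k : I) \sum_(s : 'S_N) \sum_(t : 'S_N) G (k, (s, t))).
  transitivity (\sum_(k : I) \sum_(st : 'S_N * 'S_N) G (k, st)).
    by rewrite pair_bigA; apply: eq_bigr => -[].
  by apply: eq_bigr => k _; rewrite pair_bigA; apply: eq_bigr => -[].
apply: eq_bigr => k _; apply: eq_bigr => s _; rewrite mulr_sumr.
apply: eq_bigr => t _; rewrite /G /c /= -mulrA; congr (_ * (_ * _)).
by apply: eq_bigr => i _; rewrite mxE.
Qed.

(** * Hankel matrices of beta moments *)

Definition hankel (R : pzRingType) (N k : nat) (m : nat -> R) : 'M[R]_N :=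
  \matrix_(i, j) m (k + i + j)%N.

Lemma sign_det_row_perm (R : comPzRingType) (n : nat) (s : 'S_n) (A : 'M[R]_n) :
  (-1) ^+ s * \det (row_perm s A) = \det A.
Proof. by rewrite row_permE det_mulmx det_perm mulrA -expr2 sqrr_sign mul1r. Qed.

(** Laplace expansion along the replaced row [t]: its cofactors do not involve that row, hence are
    those of [A], and the result is the diagonal entry [t] of the product. *)
Lemma sum_det_replace_row (R : comPzRingType) (n : nat) (A B : 'M[R]_n) :
  \sum_t \det (\matrix_(i, j) if i == t then B i j else A i j) = \tr (B *m \adj A).
Proof.
rewrite /mxtrace; apply: eq_bigr => t _; rewrite (expand_det_row _ t) mxE.
apply: eq_bigr => j _; rewrite !mxE eqxx; congr (_ * (_ * \det _)).
by apply/matrixP => i l; rewrite !mxE eq_sym (negPf (neq_lift t i)).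
Qed.

(** Undoing the row permutation makes all [N!] summands equal, which cancels the normalization. The
    constant 1 is a single monomial, indexed by [unit]. *)
Lemma jacobi_avg1 (R : realType) (N : nat) (a b : R) : 0 < a -> 0 < b ->
  jacobi_avg N a b (fun _ => 1) = (\det (hankel N 0 (beta_moment a b)))%:E.
Proof.
move=> a0 b0.
have -> : (fun _ : nat -> R => 1 : R) =
    (fun x => \sum_(u : unit) \prod_(i < N) x i ^+ (fun _ _ => 0%N) u i).
  by apply/funext => x; rewrite big_const card_unit/= addr0 big1.
rewrite jacobi_avgE//; congr (_%:E).
rewrite big_const card_unit/= addr0.
rewrite (eq_bigr (fun=> \det (hankel N 0 (beta_moment a b)))); last first.
  move=> s _; rewrite -[RHS](sign_det_row_perm s); congr (_ * \det _).
  by apply/matrixP => i j; rewrite !mxE.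
by rewrite sumr_const card_Sn -[X in _ * X]mulr_natl mulrA mulVf ?mul1r//.
Qed.

Lemma jacobi_avg_power_sum (R : realType) (N k : nat) (a b : R) : 0 < a -> 0 < b ->
  jacobi_avg N a b (power_sum N k) =
  (\tr (hankel N k (beta_moment a b) *m \adj (hankel N 0 (beta_moment a b))))%:E.
Proof.
move=> a0 b0.
have -> : power_sum N k =
    (fun x : nat -> R => \sum_(t : 'I_N) \prod_(i < N) x i ^+ (if i == t then k else 0%N)).
  apply/funext => x; apply: eq_bigr => t _.
  rewrite (bigD1 t)//= eqxx big1 ?mulr1// => i /negPf ->.
  by rewrite expr0.
rewrite (jacobi_avgE (fun t i => if i == t then k else 0%N))//; congr (_%:E).
rewrite -sum_det_replace_row.
pose B t : 'M[R]_N := \matrix_(i, j) if i == t then hankel N k (beta_moment a b) i j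
  else hankel N 0 (beta_moment a b) i j.
rewrite exchange_big/= (eq_bigr (fun=> \sum_t \det (B t))); last first.
  (* The marked row moves with the permutation, so the sum over [t] is reindexed by [s]. *)
  move=> s _; rewrite [RHS](reindex_inj (@perm_inj _ s))/=; apply: eq_bigr => t _.
  rewrite -[RHS](sign_det_row_perm s); congr (_ * \det _).
  apply/matrixP => i j; rewrite !mxE (inj_eq perm_inj).
  by case: eqP => // _; rewrite add0n.
by rewrite sumr_const card_Sn -[X in _ * X]mulr_natl mulrA mulVf ?mul1r//.
Qed.

Section hankel_beta.
Variables (R : realType) (a b : R) (n : nat).
Hypotheses (a0 : 0 < a) (b0 : 0 < b).
Local Notation c := (a + b).
Local Notation mom := (beta_moment a b).

Let c0 : 0 < c. Proof. exact: addr_gt0. Qed.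

Let cD_gt0 i j : 0 < c + i%:R + j%:R.
Proof. by rewrite -addrA -natrD ltr_wpDr. Qed.

(** The factor common to the moments of orders [l, ..., l + n], up to the constant [mom 0]. By
    [momE] the cofactor of the moment of order [l + j] is a polynomial in [l]. *)
Let d l := rising a l / rising c (l + n).

Let d_gt0 l : 0 < d l.
Proof. by rewrite divr_gt0 ?rising_gt0. Qed.

(** [P j] is [(a + z)_j (c + z + j)_(n-j)]; listing its [n] roots gives the degree at once. *)
Let P_roots j := [seq - (a + i%:R) | i <- iota 0 j] ++
                 [seq - (c + j%:R + i%:R) | i <- iota 0 (n - j)].
Let P j : {poly R} := \prod_(x <- P_roots j) ('X - x%:P).

Let PE j z : (P j).[z] = rising (a + z) j * rising (c + z + j%:R) (n - j).
Proof.
rewrite /P horner_prod big_cat !big_map/= /rising -(big_mkord xpredT (fun i => a + z + i%:R))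
  -(big_mkord xpredT (fun i => c + z + j%:R + i%:R)).
rewrite /index_iota !subn0; congr (_ * _); apply: eq_bigr => i _.
  by rewrite hornerXsubC opprK addrCA addrA.
by rewrite hornerXsubC opprK; ring.
Qed.

Let size_P j : (j <= n)%N -> size (P j) = n.+1.
Proof.
by move=> jn; rewrite size_prod_XsubC size_cat !size_map !size_iota subnKC.
Qed.

Let mom_rising l : mom l = mom 0 * rising a l / rising c l.
Proof.
elim: l => [|l IH]; first by rewrite !rising0 mulr1 divr1.
have cl : c + l%:R != 0 by rewrite gt_eqF// ltr_wpDr.
apply: (mulfI cl); rewrite beta_momentS// IH !risingSr.
by field; rewrite cl gt_eqF// rising_gt0.
Qed.

Let momE l j : (j <= n)%N -> mom (l + j) = mom 0 * d l * (P j).[l%:R].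
Proof.
move=> jn; rewrite mom_rising PE /d.
have -> : rising c (l + n) = rising c (l + j) * rising (c + l%:R + j%:R) (n - j).
  by rewrite -{1}(subnKC jn) addnA risingD natrD addrA.
rewrite risingD; field.
by rewrite !rising_neq0.
Qed.

Local Notation node := (fun i : nat => i%:R : R).
Local Notation L := (tnth (lagrange n.+1 node)).


Let node_inj : injective node.
Proof. by move=> i j /eqP; rewrite eqr_nat => /eqP. Qed.

Let P_lagrange j z : (j <= n)%N -> (P j).[z] = \sum_t (L t : {poly R}).[z] * (P j).[t%:R].
Proof.
(* Degree [n] and [n + 1] nodes: the interpolation is exact. *)
move=> jn; rewrite {1}(@lagrange_gen _ n.+1 node _ node_inj (P j)) ?size_P//.
by rewrite horner_sum; apply: eq_bigr => t _; rewrite hornerM hornerC mulrC.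
Qed.

(** Extracting the factors [mom 0 * d i] from the rows leaves the values of the [P j] at
    [0, ..., n]. By interpolation these determine linearly the values at any other points, so
    invertibility may be tested at better chosen ones. *)
Lemma det_hankel_beta_neq0 : \det (hankel n.+1 0 mom) != 0.
Proof.
pose D : 'rV[R]_n.+1 := \row_i (mom 0 * d i).
pose V : 'M[R]_n.+1 := \matrix_(i, j) (P j).[i%:R].
have -> : hankel n.+1 0 mom = diag_mx D *m V.
  by apply/matrixP => i j; rewrite mul_diag_mx !mxE add0n momE// -ltnS.
rewrite det_mulmx det_diag mulf_neq0//.
  apply/prodf_neq0 => i _; rewrite mxE gt_eqF// mulr_gt0//.
  by rewrite /beta_moment addr0 beta_int_gt0.
(* At the nodes [- a - i] the polynomials [P j] form a triangular matrix. *)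
pose Lam : 'M[R]_n.+1 := \matrix_(i, t) (L t : {poly R}).[- a - i%:R].
pose Q : 'M[R]_n.+1 := \matrix_(i, j) (P j).[- a - i%:R].
have QE : Q = Lam *m V.
  apply/matrixP => i j; rewrite !mxE P_lagrange -1?ltnS//.
  by apply: eq_bigr => t _; rewrite !mxE.
have : \det Q != 0.
  rewrite det_trig; last first.
    apply/is_trig_mxP => i j ij; rewrite mxE PE /rising (bigD1 (Ordinal ij))//=.
    by rewrite addrA subrr sub0r addNr !mul0r.
  (* The diagonal entry is [(-i)_i (b)_(n-i)], and neither product has a zero factor. *)
  apply/prodf_neq0 => i _; rewrite mxE PE mulf_neq0//.
    apply/prodf_neq0 => j _; rewrite addrA subrr sub0r addrC subr_eq0 eqr_nat.
    by rewrite ltn_eqF.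
  rewrite (_ : _ + i%:R = b); last by ring.
  by rewrite gt_eqF// rising_gt0.
by rewrite QE det_mulmx mulf_eq0 negb_or => /andP[].
Qed.

(** Interpolation at [k + i] expresses row [i] of [hankel n.+1 k mom] through the rows of
    [hankel n.+1 0 mom], with coefficient matrix [E]. The adjugate then produces the determinant,
    which cancels, and the trace of [E] remains. *)
Lemma Ik_lagrange k : Ik n.+1 k a b =
  \sum_(s < n.+1) rising (a + s%:R) k / rising (c + s%:R + n%:R) k *
     (L s : {poly R}).[(s + k)%:R].
Proof.
pose E : 'M[R]_n.+1 := \matrix_(i, t) (d (k + i) / d t * (L t : {poly R}).[(k + i)%:R]).
have HE : hankel n.+1 k mom = E *m hankel n.+1 0 mom.
  apply/matrixP => i j; rewrite !mxE momE -1?ltnS// P_lagrange -1?ltnS// mulr_sumr.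
  apply: eq_bigr => t _; rewrite !mxE add0n momE -1?ltnS//; field.
  by rewrite gt_eqF.
rewrite /Ik jacobi_avg1// jacobi_avg_power_sum//= HE -mulmxA mul_mx_adj.
rewrite mul_mx_scalar mxtraceZ mulrC mulKf ?det_hankel_beta_neq0//.
apply: eq_bigr => s _; rewrite mxE addnC; congr (_ * _).
rewrite /d risingD addnAC risingD natrD addrA; field.
by rewrite !rising_neq0// ltr_wpDr.
Qed.

End hankel_beta.

(** * Closed form of the average *)

Lemma prodr_natB (R : comPzRingType) (x m : nat) :
  \prod_(i < m) (x%:R - i%:R) = (x ^_ m)%:R :> R.
Proof.
elim: m => [|m IH]; first by rewrite big_ord0.
rewrite big_ord_recr/= IH ffactnSr natrM.
have [mx|xm] := leqP m x; first by rewrite natrB.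
by rewrite ffact_small// !mul0r.
Qed.

(** The denominator of a Lagrange basis polynomial at the nodes [0, ..., n]: nodes below [s]
    contribute [s!], those above it the signed [(n - s)!]. *)
Lemma prodr_natB_neq (R : comPzRingType) (n : nat) (s : 'I_n.+1) :
  \prod_(j < n.+1 | j != s) (s%:R - j%:R) =
  s`!%:R * ((-1) ^+ (n - s) * (n - s)`!%:R) :> R.
Proof.
have sn : (s <= n)%N by rewrite -ltnS.
rewrite (eq_bigl (fun j : 'I_n.+1 => (j : nat) != s))//.
rewrite -(big_mkord (fun j => j != s) (fun j => s%:R - j%:R)).
rewrite (@big_cat_nat _ _ _ s)/=; [|by []|exact: ltnW]; congr (_ * _).
  rewrite big_nat_cond (eq_bigl (fun j => (0 <= j < s)%N && true)); last first.
    by move=> j /=; case: ltngtP => //=; rewrite andbF.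
  by rewrite -big_nat_cond/= big_mkord prodr_natB ffactnn.
rewrite big_ltn_cond ?ltnS// eqxx/=.
rewrite big_nat_cond (eq_bigl (fun j => (s.+1 <= j < n.+1)%N && true)); last first.
  by move=> j /=; case: ltngtP => //=; rewrite ?andbT ?andbF.
rewrite -big_nat_cond/= -{1}(add0n s.+1) big_addn subSS big_mkord.
rewrite (eq_bigr (fun i : 'I_(n - s) => -1 * (1%:R + i%:R))); last first.
  by move=> i _; rewrite addnS -natr1 natrD; ring.
rewrite big_split/= prodr_const card_ord -/(rising _ _); congr (_ * _).
by rewrite (rising_nat R 0) add0n ffactnn.
Qed.

(** The factor [k = (s + k) - s] is the one missing from the numerator at [s + k]; it completes the
    product to a falling factorial. *)
Lemma lagrange_natE (R : realType) (n k : nat) (s : 'I_n.+1) :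
  k%:R * (s`!%:R * (n - s)`!%:R) *
    (tnth (lagrange n.+1 (fun i : nat => i%:R : R)) s : {poly R}).[(s + k)%:R] =
  (-1) ^+ (n - s) * ((s + k) ^_ n.+1)%:R.
Proof.
rewrite lagrangeE//; last by move=> i j /eqP; rewrite eqr_nat => /eqP.
rewrite hornerM hornerC !horner_prod.
have hE z : \prod_(j < n.+1 | (j : nat) != s) ('X - (j%:R)%:P).[z] =
    \prod_(j < n.+1 | j != s) (z - j%:R) :> R.
  by apply: eq_bigr => j _; rewrite hornerXsubC.
rewrite !hE prodr_natB_neq -prodr_natB [in RHS](bigD1 s)//=.
have -> : (s + k)%:R - s%:R = k%:R :> R by rewrite natrD addrAC subrr add0r.
have f0 m : m`!%:R != 0 :> R by rewrite pnatr_eq0 -lt0n fact_gt0.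
have sg : (-1) ^+ (n - s) != 0 :> R by rewrite expf_neq0// oppr_eq0 oner_eq0.
rewrite -[X in _ = X * _]invr_sign; field.
by rewrite !f0 sg.
Qed.

(** With [m + K + 1] variables and exponent [K + 1], the surviving indices are [s = m + q] with
    [q <= K], and their weights turn out to be signed binomial coefficients. *)
Lemma Ik_fdiff (R : realType) (a b : R) (K m : nat) : 0 < a -> 0 < b ->
  Ik (m + K).+1 K.+1 a b = (K.+1)`!%:R^-1 *
    iter K (@fdiff R) (fun q =>
      (rising (a + b + (m + K)%:R + m%:R + q%:R) K.+1)^-1 *
      (rising (m.+1%:R + q%:R) K.+1 * rising (a + m%:R + q%:R) K.+1)) 0.
Proof.
move=> a0 b0; rewrite (@Ik_lagrange _ _ _ (m + K))// iter_fdiffE.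
pose T (s : nat) : R :=
   rising (a + s%:R) K.+1 / rising (a + b + s%:R + (m + K)%:R) K.+1 *
   ((-1) ^+ (m + K - s) * ((s + K.+1) ^_ (m + K).+1)%:R /
     (K.+1%:R * (s`!%:R * (m + K - s)`!%:R))).
have f0 l : l`!%:R != 0 :> R by rewrite pnatr_eq0 -lt0n fact_gt0.
have k0 l : l.+1%:R != 0 :> R by rewrite pnatr_eq0.
rewrite (eq_bigr (fun s : 'I_(m + K).+1 => T s)); last first.
  move=> s _; rewrite /T -lagrange_natE; congr (_ * _).
  by rewrite mulrC mulKf// !mulf_neq0.
rewrite -(big_mkord xpredT T) -addnS (@big_cat_nat _ _ _ m)//= ?leq_addr//.
(* For [s < m] the falling factorial is longer than its base [s + K + 1], hence 0. *)
rewrite big_nat_cond big1 ?add0r; last first.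
  move=> s /andP[/andP[_ sm] _].
  by rewrite /T ffact_small ?mulr0 ?mul0r ?mulr0// addnS ltnS ltn_add2r.
rewrite -{1}(add0n m) big_addn addnC addnK big_mkord mulr_sumr.
apply: eq_bigr => q _; rewrite add0n /T.
have qK : (q <= K)%N by rewrite -ltnS.
have -> : (m + K - (q + m) = K - q)%N by rewrite addnC subnDr.
have -> : a + (q + m)%:R = a + m%:R + q%:R by rewrite natrD; ring.
have -> : a + b + (q + m)%:R + (m + K)%:R = a + b + (m + K)%:R + m%:R + q%:R.
  by rewrite !natrD; ring.
have -> : m.+1%:R + q%:R = (q + m).+1%:R :> R by rewrite -!natr1 natrD; ring.
rewrite rising_nat.
(* Everything is now written in factorials: [q!] and [(K - q)!] make up ['C(K, q)], and
   [(q + m + K + 1)! / (q + m)!] is the rising factorial of [s + 1]. *)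
have -> : ((q + m + K.+1) ^_ (m + K).+1)%:R = (q + m + K.+1)`!%:R / q`!%:R :> R.
  rewrite -(@ffact_fact (q + m + K.+1) (m + K).+1); last by rewrite -addnS -addnA leq_addl.
  by rewrite natrM -addnS -addnA addnK mulfK.
have -> : ((q + m + K.+1) ^_ K.+1)%:R = (q + m + K.+1)`!%:R / (q + m)`!%:R :> R.
  rewrite -(@ffact_fact (q + m + K.+1) K.+1) ?leq_addl//.
  by rewrite natrM addnK mulfK.
have -> : 'C(K, q)%:R = K`!%:R / (q`!%:R * (K - q)`!%:R) :> R.
  by rewrite -(bin_fact qK) !natrM mulfK// mulf_neq0.
rewrite factS natrM; field.
by rewrite !f0 nat1r k0 rising_neq0// -!addrA -!natrD addrA ltr_wpDr// addr_gt0.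
Qed.

(** Two uses of the Leibniz rule: [j] differences fall on the inverse, [i] on the first rising
    factorial and [K - j - i] on the second. In every term the numerator has exactly one factor more
    than the denominator, which gives the order of growth [N]. *)
Lemma Ik_exact (R : realType) (a b : R) (K m : nat) : 0 < a -> 0 < b ->
  Ik (m + K).+1 K.+1 a b = K.+1%:R^-1 *
    \sum_(j < K.+1) ((-1) ^+ j * 'C(j + K, j)%:R *
      \sum_(i < K.+1 - j) ('C(K.+1, i + j + 1)%:R * 'C(K.+1, i)%:R *
        ((rising (a + b + (m + K)%:R + m%:R) (K.+1 + j))^-1 *
         (rising (m.+1%:R + (j + i)%:R) (K.+1 - i) * rising (a + m%:R + K%:R) (i + j + 1))))).
Proof.
move=> a0 b0; rewrite Ik_fdiff// iter_fdiffM !mulr_sumr; apply: eq_bigr => j _.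
have jK : (j <= K)%N by rewrite -ltnS.
have f0 l : l`!%:R != 0 :> R by rewrite pnatr_eq0 -lt0n fact_gt0.
rewrite iter_fdiff_rising_inv ?addr0; last first.
  by rewrite -!addrA -!natrD addrA ltr_wpDr// addr_gt0.
rewrite add0n iter_fdiffM -subSn// !mulr_sumr; apply: eq_bigr => i _.
have iKj : (i <= K - j)%N by rewrite -ltnS -subSn.
rewrite !iter_fdiff_rising.
have -> : (j + i + (K - j - i) = K)%N by rewrite -addnA subnKC// subnKC.
have -> : (K.+1 - (K - j - i) = i + j + 1)%N by lia.
have -> : 'C(K.+1, i + j + 1) = 'C(K.+1, K - j - i).
  by rewrite -bin_sub; [congr binomial; lia|lia].
(* The weights ['C(K, j) * 'C(K - j, i)] cancel against [j!], [i!] and [(K - j - i)!] from the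
   differences, up to [K!]; divided by [(K + 1)!] this leaves [1 / (K + 1)]. *)
rewrite rising_nat (addnC j K) -!bin_ffact factS -(bin_fact jK) -(bin_fact iKj) !natrM.
have C0 n p : (p <= n)%N -> 'C(n, p)%:R != 0 :> R by move=> pn; rewrite pnatr_eq0 -lt0n bin_gt0.
field.
rewrite !f0 nat1r pnatr_eq0/= !C0// rising_neq0//.
by rewrite -!addrA -!natrD addrA ltr_wpDr// addr_gt0.
Qed.

(** * The limit *)

Lemma affine_ratio_cvg (R : realType) (w : nat -> R) (u v : R) :
  (forall n, w n != 0) -> (w n)^-1 @[n --> \oo] --> (0 : R) ->
  (u * w n + v) / w n @[n --> \oo] --> u.
Proof.
move=> w0 wcvg.
have -> : (fun n => (u * w n + v) / w n) = (fun n => u + v * (w n)^-1).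
  by apply/funext => n; rewrite mulrDl mulfK.
rewrite -[X in _ --> X]addr0; apply: cvgD; first exact: cvg_cst.
by rewrite -[X in _ --> X](mulr0 v); apply: cvgM => //; exact: cvg_cst.
Qed.

Lemma rising_ratio_cvg (R : realType) (w z : nat -> R) (l : R) (p : nat) :
  (w n)^-1 @[n --> \oo] --> (0 : R) -> z n / w n @[n --> \oo] --> l ->
  rising (z n) p / w n ^+ p @[n --> \oo] --> l ^+ p.
Proof.
move=> wcvg zcvg; elim: p => [|p IH].
  have -> : (fun n => rising (z n) 0 / w n ^+ 0) = (fun=> 1).
    by apply/funext => n; rewrite rising0 expr0 divr1.
  exact: cvg_cst.
have -> : (fun n => rising (z n) p.+1 / w n ^+ p.+1) =
    (fun n => (rising (z n) p / w n ^+ p) * (z n / w n + p%:R * (w n)^-1)).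
  by apply/funext => n; rewrite risingSr exprSr invfM mulrACA mulrDl.
rewrite exprSr; apply: cvgM => //.
rewrite -[X in _ --> X]addr0; apply: cvgD => //.
by rewrite -[X in _ --> X](mulr0 p%:R); apply: cvgM => //; exact: cvg_cst.
Qed.

(** A negative slope would make the expression negative beyond [v / - u]. Applied to both
    parameters, this makes [2 + a1 + b1] positive. *)
Lemma affine_pos_ge0 (R : archiRealFieldType) (u v : R) :
  (forall N : nat, (0 < N)%N -> 0 < u * N%:R + v) -> 0 <= u.
Proof.
move=> h; rewrite leNgt; apply/negP => u0.
pose N := (Num.truncn (v / - u)).+1.
have := h N isT; have : v / - u < N%:R by exact: truncnS_gt.
rewrite ltr_pdivrMr ?oppr_gt0// => h1 h2; lra.
Qed.

Unset Implicit Arguments.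

Theorem theorem2 (R : realType) (a0 a1 b0 b1 : R)
  (ha : forall N : nat, (0 < N)%N -> 0 < a1 * N%:R + a0)
  (hb : forall N : nat, (0 < N)%N -> 0 < b1 * N%:R + b0)
  (k : nat) (hk : (1 <= k)%N) :
  (fun N : nat => Ik N.+1 k (a1 * N.+1%:R + a0) (b1 * N.+1%:R + b0) / N.+1%:R)
    @ \oo -->
  (1 + a1) / (k%:R * (2 + a1 + b1) ^+ k) *
  \sum_(j < k) ((-1) ^+ j * ((1 + a1) / (2 + a1 + b1)) ^+ j * ('C(j + k - 1, j))%:R *
     \sum_(i < k - j) ((1 + a1) ^+ i * ('C(k, i + j + 1))%:R * ('C(k, i))%:R)).
Proof.
case: k hk => // K _.
have a1_ge0 := affine_pos_ge0 ha.
have b1_ge0 := affine_pos_ge0 hb.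
set alpha := 1 + a1; set beta := 2 + a1 + b1.
have beta0 : beta != 0 by rewrite gt_eqF// /beta; lra.
(* The limit is put in the shape of [Ik_exact], each rising factorial being replaced by the limit of
   its quotient by a power of the number of variables; [1] is that limit for the middle one. *)
have LE : alpha / (K.+1%:R * beta ^+ K.+1) *
   \sum_(j < K.+1) ((-1) ^+ j * (alpha / beta) ^+ j * 'C(j + K.+1 - 1, j)%:R *
     \sum_(i < K.+1 - j) (alpha ^+ i * 'C(K.+1, i + j + 1)%:R * 'C(K.+1, i)%:R)) =
   K.+1%:R^-1 * \sum_(j < K.+1) ((-1) ^+ j * 'C(j + K, j)%:R *
      \sum_(i < K.+1 - j) ('C(K.+1, i + j + 1)%:R * 'C(K.+1, i)%:R *
        ((beta ^+ (K.+1 + j))^-1 * (1 ^+ (K.+1 - i) * alpha ^+ (i + j + 1))))).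
  rewrite !mulr_sumr; apply: eq_bigr => j _; rewrite !mulr_sumr; apply: eq_bigr => i _.
  rewrite addnS subn1/= expr1n mul1r expr_div_n !exprD expr1; field.
  by rewrite !expf_neq0// nat1r pnatr_eq0.
rewrite LE; set L := (X in _ --> X).
(* [Ik_exact] covers at least [K + 1] variables, so finitely many terms are dropped. *)
suff : (fun m => Ik (m + K).+1 K.+1 (a1 * (m + K).+1%:R + a0)
    (b1 * (m + K).+1%:R + b0) / (m + K).+1%:R) @ \oo --> L.
  by move=> h; rewrite -(cvg_shiftn K); exact: h.
rewrite {}/L.
pose w (m : nat) : R := (m + K).+1%:R.
have w0 m : w m != 0 by rewrite pnatr_eq0.
have wcvg : (w m)^-1 @[m --> \oo] --> (0 : R).
  have := @cvg_harmonic R; rewrite -(cvg_shiftn K); exact.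
pose B m : R := a1 * w m + a0 + (b1 * w m + b0) + (m + K)%:R + m%:R.
have wE m : m%:R = w m - K.+1%:R :> R by rewrite /w -addnS natrD addrK.
have mKE m : (m + K)%:R = w m - 1 :> R by rewrite /w -natr1 addrK.
have Bcvg : B m / w m @[m --> \oo] --> beta.
  have -> : (fun m => B m / w m) =
      (fun m => (beta * w m + (a0 + b0 - 1 - K.+1%:R)) / w m).
    by apply/funext => m; rewrite /B mKE wE /beta; congr (_ / _); ring.
  exact: affine_ratio_cvg.
have B0 m : 0 < B m.
  by rewrite /B -addrA -natrD ltr_wpDr// addr_gt0 ?ha ?hb.
pose Y m : R := a1 * w m + a0 + m%:R + K%:R.
have Ycvg : Y m / w m @[m --> \oo] --> alpha.
  have -> : (fun m => Y m / w m) =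
      (fun m => (alpha * w m + (a0 - K.+1%:R + K%:R)) / w m).
    by apply/funext => m; rewrite /Y wE /alpha; congr (_ / _); ring.
  exact: affine_ratio_cvg.
pose X p m : R := m.+1%:R + p%:R.
have Xcvg p : X p m / w m @[m --> \oo] --> (1 : R).
  have -> : (fun m => X p m / w m) =
      (fun m => (1 * w m + (1 - K.+1%:R + p%:R)) / w m).
    by apply/funext => m; rewrite /X -natr1 wE; congr (_ / _); ring.
  exact: affine_ratio_cvg.
(* Each rising factorial is divided by [w m] to the power of its length; the one spare factor [w m]
   in the numerator is the division by the number of variables. *)
pose Z (j i : nat) (m : nat) : R := (rising (B m) (K.+1 + j) / w m ^+ (K.+1 + j))^-1 *
   (rising (X (j + i)%N m) (K.+1 - i) / w m ^+ (K.+1 - i) *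
    (rising (Y m) (i + j + 1) / w m ^+ (i + j + 1))).
have Zcvg j i : Z j i m @[m --> \oo] -->
    (beta ^+ (K.+1 + j))^-1 * (1 ^+ (K.+1 - i) * alpha ^+ (i + j + 1)).
  apply: cvgM; last by apply: cvgM; exact: rising_ratio_cvg.
  by apply: cvgV; [rewrite expf_neq0|exact: rising_ratio_cvg].
have -> : (fun m => Ik (m + K).+1 K.+1 (a1 * (m + K).+1%:R + a0) (b1 * (m + K).+1%:R + b0)
     / (m + K).+1%:R) =
  (fun m => K.+1%:R^-1 * \sum_(j < K.+1) ((-1) ^+ j * 'C(j + K, j)%:R *
      \sum_(i < K.+1 - j) ('C(K.+1, i + j + 1)%:R * 'C(K.+1, i)%:R * Z j i m))).
  apply/funext => m; rewrite Ik_exact ?ha ?hb// -mulrA; congr (_ * _).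
  rewrite mulr_suml; apply: eq_bigr => j _; rewrite -[LHS]mulrA; congr (_ * _).
  rewrite mulr_suml; apply: eq_bigr => i _; rewrite -[LHS]mulrA; congr (_ * _).
  have jK : (j <= K)%N by rewrite -ltnS.
  have iKj : (i <= K - j)%N by rewrite -ltnS -subSn.
  (* The count of factors; [i <= K - j] keeps the subtraction [K.+1 - i] from truncating. *)
  have wE1 : w m ^+ (K.+1 + j) * w m = w m ^+ (K.+1 - i) * w m ^+ (i + j + 1).
    by rewrite -exprSr -exprD; congr (_ ^+ _); lia.
  rewrite /Z -/(w m) -/(B m) -/(Y m) -/(X _ m).
  have -> : (rising (B m) (K.+1 + j) / w m ^+ (K.+1 + j))^-1 =
    (rising (B m) (K.+1 + j))^-1 * (w m ^+ (K.+1 - i) * w m ^+ (i + j + 1) / w m).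
    by rewrite -wE1 mulfK// invfM invrK.
  by field; rewrite !expf_neq0 ?rising_neq0// -natrD nat1r pnatr_eq0.
apply: cvgM; first exact: cvg_cst.
apply: cvg_big => [|j _]; first exact: add_continuous.
apply: cvgM; first exact: cvg_cst.
apply: cvg_big => [|i _]; first exact: add_continuous.
by apply: cvgM; [exact: cvg_cst|exact: Zcvg].
Qed.
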